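(* Let $h\in\Gamma_0(\mathbb{R}^N)$ be separable, $h(x)=\sum_{i=1}^Nh_i(x_i)$, and let $V=D\pm uu^\top$ be symmetric positive definite (one fixed choice of sign), where $D$ is diagonal with strictly positive diagonal entries $d_i$ and $u\in\mathbb{R}^N$. Assume that for $1\le i\le N$, $\mathrm{prox}_{h_i/d_i}$ is piecewise affine on $\mathbb{R}$ with $k_i\ge1$ segments, i.e. $$\mathrm{prox}_{h_i/d_i}(x_i)=\begin{cases}a^i_0x_i+b^i_0,&\text{if }x_i\le t^i_1;\\ a^i_jx_i+b^i_j,&\text{if }t^i_j\le x_i\le t^i_{j+1},\ j\in\{1,\dots,k_i\};\\ a^i_{k_i+1}x_i+b^i_{k_i+1},&\text{if }t^i_{k_i+1}\le x_i,\end{cases}$$ for some $a^i_j,b^i_j\in\mathbb{R}$ and breakpoints $t^i_1\leq\dots\leq t^i_{k_i+1}$, and define $t^i_0:=-\infty$, $t^i_{k_i+2}:=+\infty$. Then, for every $x\in\mathbb{R}^N$, $\mathrm{prox}^V_h(x)$ can be obtained exactly using the root-finding algorithm described in the context, with binary search in its Step 3, in $O(K\log K)$ steps, where $K=\sum_{i=1}^Nk_i$.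
   Context: $\Gamma_0(\mathbb{R}^N)$: proper lower semicontinuous convex functions $\mathbb{R}^N\to\mathbb{R}\cup\{+\infty\}$. For $V$ symmetric positive definite, $\mathrm{prox}^V_h(x)=\operatorname{argmin}_z\{h(z)+\tfrac12\langle x-z,V(x-z)\rangle\}$; on $\mathbb{R}$, $\mathrm{prox}_g(x)=\operatorname{argmin}_z\{g(z)+\tfrac12(x-z)^2\}$. Steps are counted as exact real arithmetic operations and comparisons. One has $\mathrm{prox}^V_h(x)=\big(\mathrm{prox}_{h_i/d_i}(x_i\mp\alpha^\star u_i/d_i)\big)_{i=1}^N$, where $\alpha^\star$ is the unique root of the continuous strictly increasing function $\mathcal{L}(\alpha)=\langle u,x-(\mathrm{prox}_{h_i/d_i}(x_i\mp\alpha u_i/d_i))_{i=1}^N\rangle+\alpha$ (upper signs for $V=D+uu^\top$, lower signs for $V=D-uu^\top$). Algorithm (computing $\alpha^\star$): 1. Sort the set $\bigcup_{i:\,u_i\ne0}\{\pm\frac{d_i}{u_i}(x_i-t^i_j):j=1,\dots,k_i+1\}\subset\mathbb{R}$ into a list $\theta_1<\dots<\theta_{k'}$. 2. Set $\overline{\theta}=[-\infty,\theta_1,\dots,\theta_{k'},+\infty]$. 3. By bisection over this list (evaluating the sign of $\mathcal{L}$ at breakpoints), find the interval $[\theta_-,\theta_+)$ with adjacent $\theta_-,\theta_+\in\overline{\theta}$ that contains the root of $\mathcal{L}$. 4. Output $\alpha^\star=-b/a$, where, choosing for each $i$ an index $j_i\in\{0,\dots,k_i+1\}$ such that $t^i_{j_i}\le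 x_i\mp\alpha u_i/d_i\le t^i_{j_i+1}$ for all $\alpha\in(\theta_-,\theta_+)$, $$a=1\pm\sum_{i=1}^Na^i_{j_i}u_i^2/d_i,\qquad b=\sum_{i=1}^Nu_i\big((1-a^i_{j_i})x_i-b^i_{j_i}\big).$$ Then $\mathrm{prox}^V_h(x)$ is obtained from $\alpha^\star$ by the formula above. *)

(* Defs.v *)
From mathcomp Require Import all_boot all_order all_algebra.
From mathcomp Require Import all_classical all_reals all_analysis.
Import Order.TTheory GRing.Theory Num.Theory.
Import numFieldNormedType.Exports.

Set Implicit Arguments.
Unset Strict Implicit.
Unset Printing Implicit Defensive.

(** * Exact real arithmetic with step counting

  [comp T A] is the type of computation trees over numbers of type [T] that
  return a value in [A].  The algorithms below are written for an arbitrary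
  type [T], so that the only way for them to produce a new number is a node
  [Const] or [Arith], and the only way to inspect a number is a node [Test].
  In particular no arithmetic can hide in index or list manipulations. *)

Variant arith := Add | Sub | Mul | Div.
Variant test := CmpLe | CmpEq.

Inductive comp (T A : Type) : Type :=
| Ret of A
| Const of nat & (T -> comp T A)
| Arith of arith & T & T & (T -> comp T A)
| Test of test & T & T & (bool -> comp T A).
Arguments Ret {T A} _.

Fixpoint bind (T A B : Type) (c : comp T A) (f : A -> comp T B) : comp T B :=
  match c with
  | Ret a => f a
  | Const n k => Const n (fun y => bind (k y) f)
  | Arith o y z k => Arith o y z (fun w => bind (k w) f)
  | Test o y z k => Test o y z (fun w => bind (k w) f)
  end.

Notation "'let*' x := c 'in' k" := (bind c (fun x => k))
  (at level 200, x name, c at level 100, k at level 200,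
   format "'[v' 'let*'  x  :=  c  'in' '/' k ']'").

Section Semantics.
Variable R : realType.
Local Open Scope ring_scope.

Definition arith_eval (o : arith) (y z : R) : R :=
  match o with Add => y + z | Sub => y - z | Mul => y * z | Div => y / z end.

Definition test_eval (o : test) (y z : R) : bool :=
  match o with CmpLe => y <= z | CmpEq => y == z end.

Fixpoint run (A : Type) (c : comp R A) : A :=
  match c with
  | Ret a => a
  | Const n k => run (k n%:R)
  | Arith o y z k => run (k (arith_eval o y z))
  | Test o y z k => run (k (test_eval o y z))
  end.

(* Number of arithmetic operations and comparisons on the execution path. *)
Fixpoint steps (A : Type) (c : comp R A) : nat :=
  match c with
  | Ret _ => 0
  | Const n k => steps (k n%:R)
  | Arith o y z k => (steps (k (arith_eval o y z))).+1
  | Test o y z k => (steps (k (test_eval o y z))).+1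
  end.

End Semantics.

Section Control.
Variables (T A B : Type).

Fixpoint mapM (f : A -> comp T B) (s : seq A) : comp T (seq B) :=
  if s is x :: s' then
    let* y := f x in let* r := mapM f s' in Ret (y :: r)
  else Ret [::].

Fixpoint foldM (f : B -> A -> comp T B) (z : B) (s : seq A) : comp T B :=
  if s is x :: s' then let* z' := f z x in foldM f z' s' else Ret z.

End Control.

Fixpoint ffunM (T A : Type) (n : nat) :
    ('I_n -> comp T A) -> comp T ('I_n -> A) :=
  match n with
  | 0 => fun _ => Ret (fun i : 'I_0 => match notF (valP i) with end)
  | n'.+1 => fun f =>
      let* y := f ord0 in
      let* g := ffunM (fun j => f (lift ord0 j)) in
      Ret (fun i => if unlift ord0 i is Some j then g j else y)
  end.

(** * Piecewise affine data

  Breakpoints are [bp 1 <= ... <= bp k.+1] ([bp 0] is unused), and the affine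
  pieces are [y |-> slope j * y + icpt j] for [0 <= j <= k.+1]. *)

Record pwa (T : Type) := Pwa {
  nseg : nat;
  bp : nat -> T;
  slope : nat -> T;
  icpt : nat -> T
}.

(** * The root-finding algorithm *)

Section Algorithm.
Variable T : Type.

Definition constM (n : nat) : comp T T := Const n Ret.
Definition addM (y z : T) : comp T T := Arith Add y z Ret.
Definition subM (y z : T) : comp T T := Arith Sub y z Ret.
Definition mulM (y z : T) : comp T T := Arith Mul y z Ret.
Definition divM (y z : T) : comp T T := Arith Div y z Ret.
Definition leM (y z : T) : comp T bool := Test CmpLe y z Ret.
Definition eqM (y z : T) : comp T bool := Test CmpEq y z Ret.

Fixpoint merge_le (s1 : seq T) : seq T -> comp T (seq T) :=
  if s1 is x1 :: s1' then
    fix merge_s1 (s2 : seq T) :=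
      if s2 is x2 :: s2' then
        let* b := leM x1 x2 in
        if b then let* r := merge_le s1' s2 in Ret (x1 :: r)
        else let* r := merge_s1 s2' in Ret (x2 :: r)
      else Ret s1
  else fun s2 => Ret s2.

(* Merge sort; [n] bounds the recursion depth, [n = size s] suffices. *)
Fixpoint sort_le (n : nat) (s : seq T) : comp T (seq T) :=
  if n is n'.+1 then
    if size s <= 1 then Ret s else
    let* s1 := sort_le n' (take (size s)./2 s) in
    let* s2 := sort_le n' (drop (size s)./2 s) in
    merge_le s1 s2
  else Ret s.

(* On a sorted sequence, equal entries are adjacent. *)
Fixpoint undup_sorted (s : seq T) : comp T (seq T) :=
  if s is x :: s' then
    if s' is y :: _ then
      let* b := eqM x y in
      let* r := undup_sorted s' in
      Ret (if b then r else x :: r)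
    else Ret s
  else Ret [::].

Definition sort_set (s : seq T) : comp T (seq T) :=
  let* s' := sort_le (size s) s in undup_sorted s'.

(* The least [j' >= j] with [y <= bp P j'.+1], or [j + n] if there is none with
   [j' < j + n]; from [j = 0] and [n = (nseg P).+1] this is the index of a piece
   that contains [y]. *)
Fixpoint scan (P : pwa T) (y : T) (n j : nat) : comp T nat :=
  if n is n'.+1 then
    let* b := leM y (bp P j.+1) in
    if b then Ret j else scan P y n' j.+1
  else Ret j.

Definition piece (P : pwa T) (y : T) : comp T nat := scan P y (nseg P).+1 0.

Definition eval_pwa (P : pwa T) (y : T) : comp T T :=
  let* j := piece P y in
  let* v := mulM (slope P j) y in
  addM v (icpt P j).

Variables (N : nat) (plus : bool) (d u : 'cV[T]_N) (P : 'I_N -> pwa T).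
Variable x : 'cV[T]_N.

(* [plus] is the sign in [V = D +- u u^T]. *)
Definition pm (y z : T) : comp T T := if plus then addM y z else subM y z.
Definition mp (y z : T) : comp T T := if plus then subM y z else addM y z.

(* [x_i -+ alpha u_i / d_i] *)
Definition shift (alpha : T) (i : 'I_N) : comp T T :=
  let* v := mulM alpha (u i ord0) in
  let* w := divM v (d i ord0) in
  mp (x i ord0) w.

Definition eval_prox (alpha : T) (i : 'I_N) : comp T T :=
  let* y := shift alpha i in eval_pwa (P i) y.

Definition eval_L (alpha : T) : comp T T :=
  foldM (fun s i =>
    let* p := eval_prox alpha i in
    let* v := subM (x i ord0) p in
    let* w := mulM (u i ord0) v in
    addM s w) alpha (enum 'I_N).

Definition breakpoints (i : 'I_N) : comp T (seq T) :=
  let* zero := constM 0 in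
  let* b := eqM (u i ord0) zero in
  if b then Ret [::] else
  mapM (fun j =>
    let* q := divM (d i ord0) (u i ord0) in
    let* r := subM (x i ord0) (bp (P i) j) in
    let* v := mulM q r in
    pm zero v) (iota 1 (nseg (P i)).+1).

Definition theta : comp T (seq T) :=
  let* ss := mapM breakpoints (enum 'I_N) in sort_set (flatten ss).

Definition theta_bar (th : seq T) : seq (\bar T) :=
  (-oo%E :: map EFin th) ++ [:: +oo%E].

Definition L_le0 (alpha : \bar T) : comp T bool :=
  match alpha with
  | EFin r => let* v := eval_L r in let* zero := constM 0 in leM v zero
  | -oo%E => Ret true
  | +oo%E => Ret false
  end.

(* Maintains that the root of L is in [th_lo, th_hi); [n] bounds the recursion
   depth, [n = size th] suffices. *)
Fixpoint bisect (th : seq (\bar T)) (n lo hi : nat) : comp T nat :=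
  if n is n'.+1 then
    if hi - lo <= 1 then Ret lo else
    let mid := (lo + hi)./2 in
    let* b := L_le0 (nth +oo%E th mid) in
    if b then bisect th n' mid hi else bisect th n' lo mid
  else Ret lo.

Definition bracket (th : seq (\bar T)) : comp T (\bar T * \bar T) :=
  let* lo := bisect th (size th) 0 (size th).-1 in
  Ret (nth +oo%E th lo, nth +oo%E th lo.+1).

(* A point of the nonempty interval (th_-, th_+).  No breakpoint of L lies in
   this interval, so a piece containing [shift alpha i] for one point alpha of
   the interval contains it for all of them. *)
Definition sample (I : \bar T * \bar T) : comp T T :=
  match I with
  | (EFin l, EFin r) =>
      let* two := constM 2 in let* v := addM l r in divM v two
  | (EFin l, _) => let* one := constM 1 in addM l one
  | (_, EFin r) => let* one := constM 1 in subM r one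
  | _ => constM 0
  end.

Definition root_of (I : \bar T * \bar T) : comp T T :=
  let* zero := constM 0 in
  let* one := constM 1 in
  let* m := sample I in
  let* ab := foldM (fun ab i =>
    let* y := shift m i in
    let* j := piece (P i) y in
    let* u2 := mulM (u i ord0) (u i ord0) in
    let* au2 := mulM (slope (P i) j) u2 in
    let* v := divM au2 (d i ord0) in
    let* a := addM ab.1 v in
    let* c := subM one (slope (P i) j) in
    let* cx := mulM c (x i ord0) in
    let* w := subM cx (icpt (P i) j) in
    let* uw := mulM (u i ord0) w in
    let* b := addM ab.2 uw in
    Ret (a, b)) (zero, zero) (enum 'I_N) in
  let* a := pm one ab.1 in
  let* mb := subM zero ab.2 in
  divM mb a.

Definition root_finding : comp T T :=
  let* th := theta in
  let* I := bracket (theta_bar th) in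
  root_of I.

Definition prox_algorithm : comp T 'cV[T]_N :=
  let* alpha := root_finding in
  let* p := ffunM (eval_prox alpha) in
  Ret (\col_i p i)%R.

End Algorithm.

(** * Convex functions and proximal mappings *)

Section Prox.
Variable R : realType.
Local Open Scope classical_set_scope.
Local Open Scope ring_scope.

Definition proper_ereal (E : Type) (f : E -> \bar R) : Prop :=
  (forall x, f x != -oo%E) /\ (exists x, f x != +oo%E).

(* With the library convention 0 * +oo = 0 the cases t = 0, 1 hold trivially. *)
Definition convex_ereal (E : lmodType R) (f : E -> \bar R) : Prop :=
  forall (x y : E) (t : R), 0 <= t <= 1 ->
    (f (t *: x + (1 - t) *: y)%R <= t%:E * f x + (1 - t)%:E * f y)%E.

Definition Gamma0 (N : nat) (f : 'cV[R]_N -> \bar R) : Prop :=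
  [/\ proper_ereal f, lower_semicontinuous f & convex_ereal f].

Definition dot (N : nat) (y z : 'cV[R]_N) : R := (y^T *m z) ord0 ord0.

Definition sym_posdef (N : nat) (V : 'M[R]_N) : Prop :=
  V^T = V /\ forall y : 'cV[R]_N, y != 0 -> 0 < dot y (V *m y).

Definition argmin (E : Type) (F : E -> \bar R) : set E :=
  [set z | forall w, (F z <= F w)%E].

(* The proximal mappings are set-valued here: prox(x) = p in the usual sense,
   i.e. p is the unique minimiser, is written [prox x = [set p]]. *)
Definition proxV (N : nat) (V : 'M[R]_N) (h : 'cV[R]_N -> \bar R)
    (x : 'cV[R]_N) : set 'cV[R]_N :=
  argmin (fun z => (h z + (2^-1 * dot (x - z) (V *m (x - z)))%:E)%E).

Definition prox (g : R -> \bar R) (x : R) : set R :=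
  argmin (fun z => (g z + (2^-1 * (x - z) ^+ 2)%:E)%E).

Definition prox_piecewise_affine (g : R -> \bar R) (P : pwa R) : Prop :=
  [/\ (1 <= nseg P)%N,
      forall j, (1 <= j <= nseg P)%N -> bp P j <= bp P j.+1 &
      forall y : R,
      [/\ y <= bp P 1 -> prox g y = [set slope P 0 * y + icpt P 0],
          forall j, (1 <= j <= nseg P)%N -> bp P j <= y <= bp P j.+1 ->
            prox g y = [set slope P j * y + icpt P j] &
          bp P (nseg P).+1 <= y ->
            prox g y =
              [set slope P (nseg P).+1 * y + icpt P (nseg P).+1] ] ].

Definition metric (N : nat) (plus : bool) (d u : 'cV[R]_N) : 'M[R]_N :=
  if plus then diag_mx d^T + u *m u^T else diag_mx d^T - u *m u^T.

End Prox.

(* Main.v *)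
(** Each scalar prox yields a subgradient, d_i (y - p) in the subdifferential of
    h_i at p = prox_{h_i/d_i}(y), hence is firmly nonexpansive; together with
    positive definiteness (for the minus sign: sum u_i^2/d_i < 1) this makes L
    strictly increasing.  At a root of L these subgradients assemble into
    V (x - p), and strong convexity of the V-norm gives that p is the unique
    minimiser.  On a closed bracket [th_-, th_+] no scalar argument crosses a
    breakpoint, so L is affine there, with positive slope because the bracket
    contains two points; the sign change of L puts -b/a in the closed bracket.

    For the cost, since every k_i >= 1 there are at most 2K breakpoints, so merge
    sort takes O(K log K) steps and bisection O(log K) evaluations of L, each of
    O(K) steps. *)

Require Import Defs.
From mathcomp Require Import all_boot all_order all_algebra.
From mathcomp Require Import all_classical all_reals all_analysis.
From mathcomp Require Import ring lra zify.
Import Order.TTheory GRing.Theory Num.Theory.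
Import numFieldNormedType.Exports.
Set Implicit Arguments.
Unset Strict Implicit.
Unset Printing Implicit Defensive.
Local Open Scope classical_set_scope.
Local Open Scope ring_scope.

(** * Values and step counts of the program combinators *)

Section Combinators.
Variable R : realType.
Implicit Types A B : Type.

Lemma run_bind A B (c : Defs.comp R A) (f : A -> Defs.comp R B) :
  run (bind c f) = run (f (run c)).
Proof. by elim: c => [a|n k IH|o y z k IH|o y z k IH] //=; rewrite IH. Qed.

Lemma steps_bind A B (c : Defs.comp R A) (f : A -> Defs.comp R B) :
  steps (bind c f) = (steps c + steps (f (run c)))%N.
Proof. by elim: c => [a|n k IH|o y z k IH|o y z k IH] //=; rewrite IH. Qed.

Lemma run_mapM A B (f : A -> Defs.comp R B) s :
  run (mapM f s) = [seq run (f x) | x <- s].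
Proof. by elim: s => //= x s IH; rewrite !run_bind /= IH. Qed.

Lemma steps_mapM A B (f : A -> Defs.comp R B) s :
  steps (mapM f s) = (\sum_(x <- s) steps (f x))%N.
Proof.
elim: s => [|x s IH] /=; first by rewrite big_nil.
by rewrite !steps_bind /= IH big_cons addn0.
Qed.

Lemma run_foldM A B (f : B -> A -> Defs.comp R B) z s :
  run (foldM f z s) = foldl (fun z x => run (f z x)) z s.
Proof. by elim: s z => //= x s IH z; rewrite run_bind IH. Qed.

Lemma steps_foldM A B (f : B -> A -> Defs.comp R B) (c : A -> nat) z s :
  (forall z x, steps (f z x) <= c x)%N ->
  (steps (foldM f z s) <= \sum_(x <- s) c x)%N.
Proof.
move=> fc; elim: s z => //= x s IH z.
by rewrite steps_bind big_cons leq_add.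
Qed.

Lemma run_ffunM A n (f : 'I_n -> Defs.comp R A) i : run (ffunM f) i = run (f i).
Proof.
elim: n f i => [f [] //|n IH f i] /=.
by rewrite !run_bind /=; case: unliftP => [j|] ->; rewrite ?IH.
Qed.

Lemma steps_ffunM A n (f : 'I_n -> Defs.comp R A) :
  steps (ffunM f) = (\sum_(i < n) steps (f i))%N.
Proof.
elim: n f => [f|n IH f] /=; first by rewrite big_ord0.
by rewrite !steps_bind /= IH big_ord_recl addn0.
Qed.

End Combinators.

(** * Merge sort and removal of duplicates *)

Section Sorting.
Variable R : realType.
Implicit Types s : seq R.

Lemma run_merge_le s1 s2 : run (merge_le s1 s2) = merge <=%R s1 s2.
Proof.
elim: s1 s2 => //= x1 s1 IH1; elim=> //= x2 s2 IH2.
by case: ifP => _; rewrite run_bind /= ?IH1 ?IH2.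
Qed.

Lemma steps_merge_le s1 s2 :
  (steps (merge_le s1 s2) <= size s1 + size s2)%N.
Proof.
elim: s1 s2 => //= x1 s1 IH1; elim=> //= x2 s2 IH2.
case: ifP => _; rewrite steps_bind /= addn0.
  by rewrite addSn ltnS IH1.
by rewrite addnS ltnS IH2.
Qed.

Lemma perm_sort_le n s : perm_eq (run (sort_le n s)) s.
Proof.
elim: n s => //= n IH s; case: ifP => // _.
rewrite !run_bind run_merge_le perm_merge.
rewrite -[X in perm_eq _ X](cat_take_drop (size s)./2 s).
by apply: perm_cat; apply: IH.
Qed.

(** Fuel [size s] suffices because both halves of a list with at least two entries are strictly
    shorter. *)
Lemma sorted_sort_le n s :
  (size s <= n)%N -> sorted <=%R (run (sort_le n s)).
Proof.
elim: n s => [|n IH] s /=; first by rewrite leqn0 => /nilP ->.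
case: ifP => [|s_gt1 s_le]; first by case: s => [|? []].
rewrite !run_bind run_merge_le.
apply: merge_sorted; first exact: le_total.
  by apply: IH; rewrite size_takel; lia.
by apply: IH; rewrite size_drop; lia.
Qed.

(** Here [l] bounds the number of merging levels, independently of the fuel: halving a list of size
    at most 2^(l+1) gives halves of size at most 2^l, and each level costs at most [size s]
    comparisons. *)
Lemma steps_sort_le n s l :
  (size s <= 2 ^ l)%N -> (steps (sort_le n s) <= l * size s)%N.
Proof.
elim: n s l => //= n IH s l s_le; case: ifP => // s_gt1.
case: l s_le => [|l]; first by rewrite expn0; lia.
rewrite expnS => s_le; rewrite !steps_bind.
have sz1 : (size (take (size s)./2 s) = (size s)./2)%N by rewrite size_takel; lia.
have sz2 := size_drop (size s)./2 s.
have s1_le := IH (take (size s)./2 s) l; have s2_le := IH (drop (size s)./2 s) l.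
have := steps_merge_le (run (sort_le n (take (size s)./2 s)))
  (run (sort_le n (drop (size s)./2 s))).
rewrite !(perm_size (perm_sort_le _ _)) -size_cat cat_take_drop => m_le.
have {}s1_le : (steps (sort_le n (take (size s)./2 s)) <= l * (size s)./2)%N.
  by rewrite -[X in (_ <= _ * X)%N]sz1; apply: s1_le; rewrite sz1; lia.
have {}s2_le : (steps (sort_le n (drop (size s)./2 s))
    <= l * (size s - (size s)./2))%N.
  by rewrite -[X in (_ <= _ * X)%N]sz2; apply: s2_le; rewrite sz2; lia.
rewrite mulSn.
have -> : (l * size s = l * (size s)./2 + l * (size s - (size s)./2))%N.
  by rewrite -mulnDr; congr (_ * _)%N; lia.
by rewrite addnA [leqRHS]addnC !leq_add.
Qed.

Lemma run_undup_sorted x y s :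
  let r := run (Defs.undup_sorted (y :: s)) in
  run (Defs.undup_sorted [:: x, y & s]) = if x == y then r else x :: r.
Proof. by rewrite /= run_bind. Qed.

Lemma mem_undup_sorted s : run (Defs.undup_sorted s) =i s.
Proof.
elim: s => // x [|y s] // IH z; rewrite run_undup_sorted.
case: eqP => [->|_]; rewrite ?inE IH !inE //.
by rewrite orbA orbb.
Qed.

(** An entry is kept only if it differs from its successor, hence is strictly below it, and
    sortedness carries the strict inequality to all later entries. *)
Lemma sorted_undup_sorted s :
  sorted <=%R s -> sorted <%R (run (Defs.undup_sorted s)).
Proof.
elim: s => // x [|y s] // IH /andP[xy ys]; rewrite run_undup_sorted.
have {}IH := IH ys; case: eqP => // /eqP xNy.
rewrite -[sorted _ _]/(path <%R x _) lt_path_sortedE IH andbT; apply/allP => z.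
rewrite mem_undup_sorted inE => /predU1P[->|zs]; first by rewrite lt_neqAle xNy.
apply: (@lt_le_trans _ _ y); first by rewrite lt_neqAle xNy.
by move: (ys : path <=%R y s); rewrite le_path_sortedE => /andP[/allP/(_ _ zs)].
Qed.

Lemma steps_undup_sorted s : (steps (Defs.undup_sorted s) <= size s)%N.
Proof.
elim: s => // x [|y s] // IH; rewrite /= steps_bind addn0 ltnS; exact: IH.
Qed.

Lemma mem_sort_set s : run (sort_set s) =i s.
Proof.
move=> z; rewrite /sort_set run_bind mem_undup_sorted.
exact: perm_mem (perm_sort_le _ _) z.
Qed.

Lemma sorted_sort_set s : sorted <%R (run (sort_set s)).
Proof.
by rewrite /sort_set run_bind; apply/sorted_undup_sorted/sorted_sort_le.
Qed.

Lemma steps_sort_set s l :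
  (size s <= 2 ^ l)%N -> (steps (sort_set s) <= l.+1 * size s)%N.
Proof.
move=> s_le; rewrite /sort_set steps_bind mulSn addnC leq_add ?steps_sort_le //.
by rewrite (leq_trans (steps_undup_sorted _)) // (perm_size (perm_sort_le _ _)).
Qed.

Lemma size_sort_set s : (size (run (sort_set s)) <= size s)%N.
Proof.
apply: uniq_leq_size => [|x]; last by rewrite mem_sort_set.
exact: lt_sorted_uniq (sorted_sort_set s).
Qed.

End Sorting.

(** * Subgradients from scalar proximal maps *)

Section Proximal.
Variable R : realType.

(** Stands in for the limit t -> 0 without any topology. *)
Lemma ge0_of_small_perturbations (a b : R) :
  (forall t, 0 < t < 1 -> 0 <= a + t * b) -> 0 <= a.
Proof.
move=> ab; rewrite leNgt; apply/negP => a_lt0.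
have b_gt0 : 0 < b by have := ab 2^-1; lra.
have ba_gt0 : 0 < b - a by lra.
(* If a < 0 < b, this t is so small that a + t * b stays negative. *)
have t_bd : 0 < - a / (2 * (b - a)) < 1.
  by rewrite divr_gt0 ?ltr_pdivrMr; lra.
have := ab _ t_bd; apply/negP; rewrite -ltNge.
have -> : a + - a / (2 * (b - a)) * b = a * (b - 2 * a) / (2 * (b - a)).
  by field; lra.
by rewrite pmulr_llt0 ?invr_gt0 ?nmulr_rlt0; lra.
Qed.

(** Convexity restricted to points of finite value and interior weights, so that no product with an
    infinite value occurs. *)
Definition convex_on_domain (f : R -> \bar R) := forall (z w t : R),
  0 < t < 1 -> f z \is a fin_num -> f w \is a fin_num ->
  (f (t * z + (1 - t) * w)%R <= t%:E * f z + (1 - t)%:E * f w)%E.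

(** First-order optimality: the minimiser p is compared with t z + (1 - t) p, convexity bounds f
    there, and dividing by t and letting t tend to 0 leaves the subgradient inequality. The point
    [x0] makes the minimum finite. *)
Lemma prox_subgradient (f : R -> \bar R) (d x0 y p : R) :
  0 < d -> (forall z, f z != -oo%E) -> f x0 \is a fin_num ->
  convex_on_domain f -> prox (fun z => d^-1%:E * f z)%E y p ->
  f p \is a fin_num /\ forall z, (f p + (d * (y - p) * (z - p))%:E <= f z)%E.
Proof.
move=> d_gt0 fNy f0 f_convex p_min.
have d'_gt0 : 0 < d^-1 by rewrite invr_gt0.
have fp : f p \is a fin_num.
  rewrite fin_numE fNy /=; apply/eqP => fp; have := p_min x0.
  by rewrite /= fp -(fineK f0) gt0_muley ?lte_fin // -EFinM -EFinD leye_eq.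
split=> // z; case fzE: (f z) (fNy z) => [b| |] // _; last by rewrite leey.
have := fp; case fpE: (f p) => [a| |] // _; rewrite -EFinD lee_fin -subr_ge0.
(* The perturbation is what the quadratic term leaves after division by t. *)
apply: (@ge0_of_small_perturbations _ (d * 2^-1 * (z - p) ^+ 2)) => t t01.
have := p_min (t * z + (1 - t) * p); have := f_convex z p t t01.
rewrite /= fzE fpE => /(_ isT isT).
case: (f (_ + _)) (fNy (t * z + (1 - t) * p)) => [c _| |//]; last first.
  by rewrite -!EFinM -EFinD leye_eq.
rewrite -!EFinM -!EFinD !lee_fin => c_le.
rewrite -(ler_pM2l d_gt0) !mulrDr !mulrA mulfV ?gt_eqF // !mul1r => p_le.
have t_gt0 : 0 < t by lra.
rewrite -(pmulr_rge0 _ t_gt0).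
by nra.
Qed.

(** Monotonicity of the subdifferential: each subgradient inequality is taken at the other point and
    the two are added. *)
Lemma subgradients_firmly_nonexpansive (f : R -> \bar R) (d y y' p p' : R) :
  0 < d -> f p \is a fin_num -> f p' \is a fin_num ->
  (forall z, (f p + (d * (y - p) * (z - p))%:E <= f z)%E) ->
  (forall z, (f p' + (d * (y' - p') * (z - p'))%:E <= f z)%E) ->
  0 <= ((y - y') - (p - p')) * (p - p').
Proof.
move=> d_gt0 fp fp' /(_ p') + /(_ p).
case: (f p) (f p') fp fp' => [a| |] // [b| |] // _ _.
rewrite -!EFinD !lee_fin => ? ?; rewrite -(pmulr_rge0 _ d_gt0); nra.
Qed.

(** * Slices of a separable convex function *)

Section Separable.
Variables (N : nat) (h : 'cV[R]_N -> \bar R) (hi : 'I_N -> R -> \bar R).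
Hypothesis hiNy : forall i z, hi i z != -oo%E.
Hypothesis hE : forall z, h z = (\sum_(i < N) hi i (z i ord0))%E.

Lemma separable_fin_num z :
  h z != +oo%E -> forall i, hi i (z i ord0) \is a fin_num.
Proof.
move=> hz i; rewrite fin_numE hiNy /=; apply: contra hz => hiz.
rewrite hE esum_eqy; last by move=> ? _; exact: hiNy.
by apply/existsP; exists i.
Qed.

(** Along the i-th coordinate line through a point z of finite value, h is [hi i] plus a finite
    constant, so convexity passes to [hi i]. *)
Lemma separable_convex z :
  h z != +oo%E -> convex_ereal h -> forall i, convex_on_domain (hi i).
Proof.
move=> hz h_convex i a b t t01 ha hb.
pose v (c : R) : 'cV[R]_N := \col_j if j == i then c else z j ord0.
have hv c : h (v c) =
    (hi i c + (\sum_(j < N | j != i) fine (hi j (z j ord0)))%:E)%E.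
  rewrite hE (bigD1 i) //= mxE eqxx; congr (_ + _)%E.
  rewrite -sumEFin; apply: eq_bigr => j /negPf ji.
  by rewrite mxE ji fineK // separable_fin_num.
have t01' : 0 <= t <= 1 by lra.
have vE : t *: v a + (1 - t) *: v b = v (t * a + (1 - t) * b).
  by apply/matrixP => j k; rewrite !mxE; case: ifP => _ //; lra.
have := h_convex (v a) (v b) t t01'.
rewrite vE !hv -(fineK ha) -(fineK hb).
case: (hi i (_ + _)) (hiNy i (t * a + (1 - t) * b)) => [c _| |//].
  by rewrite -!EFinD !lee_fin; lra.
by rewrite addye // leye_eq.
Qed.

End Separable.

(** * The quadratic form of V and the optimality condition *)

Section Metric.
Variable N : nat.
Implicit Types y z : 'cV[R]_N.

Lemma dotE y z : dot y z = \sum_i y i ord0 * z i ord0.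
Proof. by rewrite /dot mxE; apply: eq_bigr => i _; rewrite mxE. Qed.

Lemma dotC y z : dot y z = dot z y.
Proof. by rewrite !dotE; apply: eq_bigr => i _; rewrite mulrC. Qed.

Lemma dotBl y1 y2 z : dot (y1 - y2) z = dot y1 z - dot y2 z.
Proof. by rewrite /dot !(linearB, mulmxBl) !mxE. Qed.

Lemma dotBr z y1 y2 : dot z (y1 - y2) = dot z y1 - dot z y2.
Proof. by rewrite dotC dotBl !(dotC z). Qed.

Lemma dot_mulmx_sym (V : 'M[R]_N) y z :
  V^T = V -> dot y (V *m z) = dot (V *m y) z.
Proof. by move=> Vs; rewrite /dot trmx_mul Vs mulmxA. Qed.

(* The hypothesis on [p] says that [V (x - p)] is a subgradient of [h] at [p]. *)
Lemma proxV_separable (V : 'M[R]_N) (h : 'cV[R]_N -> \bar R)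
    (hi : 'I_N -> R -> \bar R) (x p : 'cV[R]_N) :
  sym_posdef V -> (forall z, h z = (\sum_(i < N) hi i (z i ord0))%E) ->
  (forall i, hi i (p i ord0) \is a fin_num) ->
  (forall i c, (hi i (p i ord0) +
     ((V *m (x - p)) i ord0 * (c - p i ord0))%:E <= hi i c)%E) ->
  proxV V h x = [set p].
Proof.
move=> [Vs Vpos] hE p_fin p_sub.
have hp : h p = (\sum_(i < N) fine (hi i (p i ord0)))%:E.
  by rewrite hE -sumEFin; apply: eq_bigr => i _; rewrite fineK.
have h_ge w : (h p + (dot (V *m (x - p)) (w - p))%:E <= h w)%E.
  rewrite hp dotE -EFinD -big_split -sumEFin hE; apply: lee_sum => i _.
  by have := p_sub i (w i ord0); rewrite EFinD fineK //= !mxE.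
pose Q z := dot z (V *m z).
have Q_ge0 z : 0 <= Q z.
  have [->|/Vpos/ltW //] := eqVneq z 0.
  by rewrite /Q dotE big1 // => i _; rewrite mxE mul0r.
have QB a b : Q (a - b) = Q a - 2 * dot (V *m a) b + Q b.
  rewrite /Q mulmxBr dotBl !dotBr (dot_mulmx_sym a b Vs) (dotC b (V *m a)); lra.
have QE w : Q (x - w) = Q (x - p) - 2 * dot (V *m (x - p)) (w - p) + Q (w - p).
  by rewrite -QB opprB addrA subrK.
pose F z := (h z + (2^-1 * Q (x - z))%:E)%E.
(* Quadratic growth around p: dropping the Q term gives minimality, and positivity of Q off 0 gives
   uniqueness. *)
have F_ge w : (F p + (2^-1 * Q (w - p))%:E <= F w)%E.
  have := h_ge w; rewrite /F hp; case: (h w) => [b| |]; rewrite ?leey //.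
  by rewrite -!EFinD !lee_fin (QE w); lra.
have Fp : F p \is a fin_num by rewrite /F hp.
apply/seteqP; split=> [q q_min|_ -> w]; last first.
  apply: le_trans (F_ge w); rewrite -[leLHS]adde0 leeD2l //.
  by rewrite lee_fin mulr_ge0.
have q_le : (F q <= F p)%E := q_min p.
have {q_le} := le_trans (F_ge q) q_le; rewrite -(fineK Fp) -EFinD lee_fin => q_le.
apply/eqP; rewrite -subr_eq0; apply: contraT => /Vpos.
by rewrite -[dot _ _]/(Q (q - p)); lra.
Qed.

Definition sgn (plus : bool) : R := if plus then 1 else -1.

Lemma mul_metricE plus (d u y : 'cV[R]_N) i :
  (metric plus d u *m y) i ord0 =
  d i ord0 * y i ord0 + sgn plus * u i ord0 * \sum_j u j ord0 * y j ord0.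
Proof.
have uy : (u *m u^T *m y) i ord0 = u i ord0 * \sum_j u j ord0 * y j ord0.
  by rewrite -mulmxA mxE big_ord1; congr (_ * _); rewrite -dotE.
have dy : (diag_mx d^T *m y) i ord0 = d i ord0 * y i ord0.
  by rewrite mul_diag_mx !mxE.
rewrite /metric /sgn; case: plus.
  by rewrite mulmxDl mxE dy uy mul1r.
by rewrite mulmxBl !mxE; move: dy uy; rewrite !mxE => -> ->; lra.
Qed.

(** The quadratic form at y = D^-1 u equals s (1 - s), where s is the sum in question and s >= 0. *)
Lemma metric_minus_posdef (d u : 'cV[R]_N) :
  (forall i, 0 < d i ord0) -> sym_posdef (metric false d u) ->
  \sum_i u i ord0 ^+ 2 / d i ord0 < 1.
Proof.
move=> d_gt0 [_ Vpos]; set s := \sum_i _.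
pose y : 'cV[R]_N := \col_i (u i ord0 / d i ord0).
have uy : \sum_j u j ord0 * y j ord0 = s.
  by apply: eq_bigr => i _; rewrite mxE expr2 mulrA.
have [y0|/Vpos] := eqVneq y 0.
  by rewrite -uy y0 big1 ?ltr01 // => i _; rewrite mxE mulr0.
have -> : dot y (metric false d u *m y) = s * (1 - s).
  rewrite dotE -{1}uy mulr_suml; apply: eq_bigr => i _.
  rewrite mul_metricE uy /sgn !mxE mulrCA mulfV ?gt_eqF //; lra.
have s_ge0 : 0 <= s.
  by apply: sumr_ge0 => i _; rewrite divr_ge0 ?sqr_ge0 // ltW.
by nra.
Qed.

End Metric.

(* The function L of the paper. *)
Definition root_fun N (plus : bool) (d u x : 'cV[R]_N) (q : 'I_N -> R -> R)
    (alpha : R) : R :=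
  alpha + \sum_i u i ord0 *
    (x i ord0 - q i (x i ord0 - sgn plus * (alpha * u i ord0 / d i ord0))).

(** For the plus sign every summand is nondecreasing, since q is. For the minus sign
    nonexpansiveness lets the i-th summand drop by at most (beta - alpha) u_i^2 / d_i, and these
    drops add up to less than beta - alpha. *)
Lemma root_fun_increasing N plus (d u x : 'cV[R]_N) (q : 'I_N -> R -> R) :
  (forall i, 0 < d i ord0) -> sym_posdef (metric plus d u) ->
  (forall i y y', 0 <= ((y - y') - (q i y - q i y')) * (q i y - q i y')) ->
  forall alpha beta, alpha < beta ->
    root_fun plus d u x q alpha < root_fun plus d u x q beta.
Proof.
move=> d_gt0 Vpos q_fne al be al_be; rewrite -subr_gt0 /root_fun.
set del := be - al; have del_gt0 : 0 < del by rewrite subr_gt0.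
rewrite opprD addrACA -sumrB -/del.
case: plus Vpos => Vpos.
  apply: ltr_wpDr => //; apply: sumr_ge0 => i _; rewrite /sgn !mul1r.
  have := q_fne i (x i ord0 - be * u i ord0 / d i ord0)
                  (x i ord0 - al * u i ord0 / d i ord0).
  set f := q i _; set g := q i _; have := d_gt0 i.
  set D := d i ord0; set U := u i ord0 => D_gt0.
  have -> : x i ord0 - be * U / D - (x i ord0 - al * U / D) = - (del / D) * U.
    by rewrite /del; field; rewrite gt_eqF.
  have : 0 < del / D by rewrite divr_gt0.
  set e := del / D => e_gt0 fg; rewrite -(pmulr_rge0 _ e_gt0).
  by have := sqr_ge0 (f - g); nra.
have s_lt1 := metric_minus_posdef d_gt0 Vpos.
apply: (@lt_le_trans _ _ (del - del * \sum_i u i ord0 ^+ 2 / d i ord0)).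
  by rewrite subr_gt0 -[ltRHS]mulr1 ltr_pM2l.
rewrite mulr_sumr lerD2l -sumrN; apply: ler_sum => i _.
have := q_fne i (x i ord0 - sgn false * (be * u i ord0 / d i ord0))
                (x i ord0 - sgn false * (al * u i ord0 / d i ord0)).
rewrite /sgn !mulN1r !opprK.
set f := q i _; set g := q i _; have := d_gt0 i.
set D := d i ord0; set U := u i ord0 => D_gt0.
have -> : x i ord0 + be * U / D - (x i ord0 + al * U / D) = del / D * U.
  by rewrite /del; field; rewrite gt_eqF.
have -> : del * (U ^+ 2 / D) = (del / D) * U ^+ 2.
  by field; rewrite gt_eqF.
have : 0 < del / D by rewrite divr_gt0.
set e := del / D => e_gt0 fg; rewrite -subr_ge0 -(pmulr_rge0 _ e_gt0).
(* With r = e U and w = f - g: r^2 - r w = (r - w)^2 + (r - w) w, and the last product is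
   nonnegative by firm nonexpansiveness. *)
by have := sqr_ge0 (e * U - (f - g)); nra.
Qed.

End Proximal.

(** * Piecewise affine representations of proximal maps *)

Section PiecewiseAffine.
Variable R : realType.
Implicit Types P : pwa R.

(** The guards encode the outer breakpoints -oo and +oo, which [bp] does not store. *)
Definition in_piece P (j : nat) (y : R) :=
  ((0 < j)%N -> bp P j <= y) /\ ((j <= nseg P)%N -> y <= bp P j.+1).

(** The lower bound is strict because the index advances only after a failed test [y <= bp P k]. *)
Lemma run_scan P y n j (k := run (scan P y n j)) :
  [/\ (j <= k <= j + n)%N, (j < k)%N -> bp P k < y &
      (k < j + n)%N -> y <= bp P k.+1].
Proof.
rewrite {}/k; elim: n j => [|n IH] j /=.
  by split; rewrite ?addn0 ?ltnn ?leqnn.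
case: (leP y (bp P j.+1)) => [y_le|y_gt] /=; first by split; rewrite ?ltnn ?leqnn ?leq_addr.
have [k_bd k_gt k_le] := IH j.+1; split=> [|_|k_lt]; first by lia.
  have [/k_gt //|k_le_j] := ltnP j.+1 (run (scan P y n j.+1)).
  by rewrite (_ : run _ = j.+1) //; lia.
by apply: k_le; lia.
Qed.

Lemma run_piece P y (j := run (piece P y)) :
  [/\ (j <= (nseg P).+1)%N, (0 < j)%N -> bp P j < y &
      (j <= nseg P)%N -> y <= bp P j.+1].
Proof. by have [/andP[_ ?] ? ?] := run_scan P y (nseg P).+1 0. Qed.

Lemma steps_scan P y n j : (steps (scan P y n j) <= n)%N.
Proof. by elim: n j => //= n IH j; case: ifP => // _; apply: IH. Qed.

Lemma steps_piece P y : (steps (piece P y) <= (nseg P).+1)%N.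
Proof. exact: steps_scan. Qed.

Lemma run_eval_pwa P y :
  run (eval_pwa P y) =
  slope P (run (piece P y)) * y + icpt P (run (piece P y)).
Proof. by rewrite /eval_pwa run_bind. Qed.

Lemma steps_eval_pwa P y : (steps (eval_pwa P y) <= nseg P + 3)%N.
Proof.
rewrite /eval_pwa steps_bind -[X in (_ + X)%N]/2%N.
by have := steps_piece P y; lia.
Qed.

Lemma prox_in_piece (g : R -> \bar R) P j y :
  prox_piecewise_affine g P -> (j <= (nseg P).+1)%N -> in_piece P j y ->
  prox g y = [set slope P j * y + icpt P j].
Proof.
case=> nseg_gt0 _ /(_ y)[first_piece mid_piece last_piece] j_le [bp_le le_bp].
have [j0|j_gt0] := posnP j; first by move: le_bp; rewrite j0 => /(_ isT).
have [j_le'|j_gt] := leqP j (nseg P).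
  by apply: mid_piece; rewrite ?j_gt0 ?bp_le ?le_bp.
have jE : j = (nseg P).+1 by lia.
by rewrite jE in bp_le *; apply/last_piece/bp_le.
Qed.

Lemma prox_eval_pwa (g : R -> \bar R) P y :
  prox_piecewise_affine g P -> prox g y = [set run (eval_pwa P y)].
Proof.
move=> gP; have [j_le bp_lt le_bp] := run_piece P y.
by rewrite run_eval_pwa; apply: prox_in_piece => //; split=> // /bp_lt/ltW.
Qed.

(** Where pieces overlap their formulas agree, both giving the single element of prox. The piece
    found by scanning may thus be replaced by any other containing y. *)
Lemma eval_pwa_in_piece (g : R -> \bar R) P j y :
  prox_piecewise_affine g P -> (j <= (nseg P).+1)%N -> in_piece P j y ->
  run (eval_pwa P y) = slope P j * y + icpt P j.
Proof.
move=> gP j_le yj; have := prox_eval_pwa y gP.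
rewrite (prox_in_piece gP j_le yj) => /seteqP[+ _].
by move=> /(_ (slope P j * y + icpt P j) erefl).
Qed.

End PiecewiseAffine.

Lemma foldl_addr (R : realType) (I : Type) (f : I -> R) z s :
  foldl (fun z i => z + f i) z s = z + \sum_(i <- s) f i.
Proof.
elim: s z => [|i s IH] z /=; first by rewrite big_nil addr0.
by rewrite IH big_cons addrA.
Qed.

(** * Values and costs of the individual stages *)

Section AlgorithmCorrectness.
Variables (R : realType) (N : nat) (plus : bool) (d u : 'cV[R]_N).
Variables (P : 'I_N -> pwa R) (x : 'cV[R]_N).

Local Notation sg := (sgn R plus).
Local Notation L := (root_fun plus d u x (fun i y => run (eval_pwa (P i) y))).

Lemma run_pm y z : run (pm plus y z) = y + sg * z.
Proof. by rewrite /pm /sgn; case: plus; rewrite ?mul1r ?mulN1r. Qed.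

Lemma steps_pm (y z : R) : steps (pm plus y z) = 1%N.
Proof. by rewrite /pm; case: plus. Qed.

Lemma run_shift alpha i :
  run (Defs.shift plus d u x alpha i) =
  x i ord0 - sg * (alpha * u i ord0 / d i ord0).
Proof.
by rewrite /Defs.shift /mp /sgn; case: plus => /=; rewrite ?mul1r // mulN1r opprK.
Qed.

Lemma steps_shift alpha i : steps (Defs.shift plus d u x alpha i) = 3%N.
Proof. by rewrite /Defs.shift /mp; case: plus. Qed.

Lemma run_eval_prox alpha i :
  run (eval_prox plus d u P x alpha i) =
  run (eval_pwa (P i) (x i ord0 - sg * (alpha * u i ord0 / d i ord0))).
Proof. by rewrite /eval_prox run_bind run_shift. Qed.

Lemma steps_eval_prox alpha i :
  (steps (eval_prox plus d u P x alpha i) <= nseg (P i) + 6)%N.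
Proof.
rewrite /eval_prox steps_bind steps_shift.
by have := steps_eval_pwa (P i) (run (Defs.shift plus d u x alpha i)); lia.
Qed.

Lemma run_eval_L alpha : run (eval_L plus d u P x alpha) = L alpha.
Proof.
rewrite /eval_L run_foldM /root_fun -big_enum -foldl_addr.
congr foldl; apply/funext => s; apply/funext => i.
by rewrite run_bind run_eval_prox.
Qed.

Lemma steps_eval_L alpha :
  (steps (eval_L plus d u P x alpha) <= \sum_i (nseg (P i) + 9))%N.
Proof.
rewrite /eval_L -[leqRHS]big_enum; apply: steps_foldM => s i.
rewrite steps_bind -[X in (_ + X)%N]/3%N.
by have := steps_eval_prox alpha i; lia.
Qed.

Lemma breakpointsE i :
  run (breakpoints plus d u P x i) =
  if u i ord0 == 0 then [::] else
  [seq sg * (d i ord0 / u i ord0 * (x i ord0 - bp (P i) j))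
    | j <- iota 1 (nseg (P i)).+1].
Proof.
rewrite /breakpoints !run_bind -[run (eqM _ _)]/(u i ord0 == 0).
case: ifP => // _.
by rewrite run_mapM; apply: eq_map => j; rewrite /= run_pm add0r.
Qed.

Lemma steps_breakpoints i :
  (steps (breakpoints plus d u P x i) <= 4 * nseg (P i) + 5)%N.
Proof.
rewrite /breakpoints !steps_bind -[run (eqM _ _)]/(u i ord0 == 0).
rewrite -[steps (constM _ _)]/0%N -[steps (eqM _ _)]/1%N add0n.
case: ifP => _; first by rewrite /=; lia.
rewrite steps_mapM (eq_bigr (fun=> 4%N)) => [|j _]; last first.
  by rewrite /= steps_pm.
by rewrite big_const_seq count_predT size_iota iter_addn_0; lia.
Qed.

Definition all_breakpoints :=
  flatten [seq run (breakpoints plus d u P x i) | i <- enum 'I_N].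

Lemma run_theta : run (theta plus d u P x) = run (sort_set all_breakpoints).
Proof. by rewrite /theta run_bind run_mapM. Qed.

Lemma size_all_breakpoints :
  (size all_breakpoints <= \sum_i (nseg (P i)).+1)%N.
Proof.
rewrite /all_breakpoints size_flatten sumnE 2!big_map big_enum.
apply: leq_sum => i _; rewrite breakpointsE; case: ifP => // _.
by rewrite size_map size_iota.
Qed.

Lemma mem_theta i j :
  u i ord0 != 0 -> (1 <= j <= (nseg (P i)).+1)%N ->
  sg * (d i ord0 / u i ord0 * (x i ord0 - bp (P i) j))
    \in run (theta plus d u P x).
Proof.
move=> ui j_bd; rewrite run_theta mem_sort_set; apply/flattenP.
exists (run (breakpoints plus d u P x i)).
  by apply/mapP; exists i; rewrite ?mem_enum.
rewrite breakpointsE (negPf ui); apply/mapP; exists j => //.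
by rewrite mem_iota; lia.
Qed.

Lemma steps_theta l : (\sum_i (nseg (P i)).+1 <= 2 ^ l)%N ->
  (steps (theta plus d u P x) <=
   \sum_i (4 * nseg (P i) + 5) + l.+1 * \sum_i (nseg (P i)).+1)%N.
Proof.
move=> l_ge; rewrite /theta steps_bind steps_mapM run_mapM.
apply: leq_add.
  by rewrite big_enum; apply: leq_sum => i _; exact: steps_breakpoints.
rewrite -/all_breakpoints (leq_trans (steps_sort_set (leq_trans _ l_ge))) //.
  exact: size_all_breakpoints.
by rewrite leq_mul2l size_all_breakpoints orbT.
Qed.

(** * Bisection and the bracketing interval *)

Local Notation le0 := (L_le0 plus d u P x).

Lemma run_L_le0 r : run (le0 r%:E) = (L r <= 0).
Proof. by rewrite /L_le0 run_bind /= run_eval_L. Qed.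

Lemma steps_L_le0 alpha :
  (steps (le0 alpha) <= (\sum_i (nseg (P i) + 9)).+1)%N.
Proof.
case: alpha => //= r; rewrite steps_bind /= addn1 ltnS.
exact: steps_eval_L.
Qed.

(** Loop invariant: the test succeeds at [lo] and fails at [hi]. The fuel covers the gap, which
    shrinks in every round until the two indices are adjacent. *)
Lemma run_bisect th n lo hi (k := run (bisect plus d u P x th n lo hi)) :
  (lo < hi <= lo + n.+1)%N ->
  run (le0 (nth +oo%E th lo)) -> ~~ run (le0 (nth +oo%E th hi)) ->
  [/\ (lo <= k < hi)%N, run (le0 (nth +oo%E th k)) &
      ~~ run (le0 (nth +oo%E th k.+1))].
Proof.
rewrite {}/k; elim: n lo hi => [|n IH] lo hi /= lo_hi lo_le hi_gt.
  have hiE : hi = lo.+1 by lia.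
  by move: hi_gt; rewrite hiE => hi_gt; split; rewrite ?leqnn.
case: ifP => hi_lo.
  have hiE : hi = lo.+1 by lia.
  by move: hi_gt; rewrite hiE => hi_gt; split; rewrite ?leqnn.
rewrite run_bind; case: ifPn => mid_le.
  by have [|//|//|? ? ?] := IH ((lo + hi)./2)%N hi; [lia | split=> //; lia].
by have [|//|//|? ? ?] := IH lo ((lo + hi)./2)%N; [lia | split=> //; lia].
Qed.

Lemma steps_bisect th n lo hi l : (hi - lo <= 2 ^ l)%N ->
  (steps (bisect plus d u P x th n lo hi) <=
   l * (\sum_i (nseg (P i) + 9)).+1)%N.
Proof.
elim: n lo hi l => //= n IH lo hi l hi_lo; case: ifP => // hi_lo_gt1.
case: l hi_lo => [|l]; first by rewrite expn0 hi_lo_gt1.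
rewrite expnS => hi_lo; rewrite mulSn steps_bind.
by rewrite leq_add ?steps_L_le0 //; case: ifP => _; apply: IH; lia.
Qed.

(* [I] is the pair (th_-, th_+) of the paper. *)
Definition bracketing (I : \bar R * \bar R) :=
  [/\ (I.1 < I.2)%E, run (le0 I.1), ~~ run (le0 I.2) &
      forall t, t \in run (theta plus d u P x) -> (t%:E <= I.1 \/ I.2 <= t%:E)%E].

Lemma path_theta_bar (t : R) th :
  path <%R t th -> path <%O t%:E ([seq s%:E | s <- th] ++ [:: +oo%E]).
Proof.
elim: th t => [t _|s th IH t] /=; first by rewrite ltry.
by rewrite lte_fin => /andP[-> /IH].
Qed.

Lemma sorted_theta_bar (th : seq R) :
  sorted <%R th -> sorted <%O (theta_bar th).
Proof.
by case: th => [|t th] //=; rewrite ltNyr; exact: path_theta_bar.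
Qed.

Lemma bracketing_bracket :
  bracketing (run (bracket plus d u P x (theta_bar (run (theta plus d u P x))))).
Proof.
set th := run (theta _ _ _ _ _).
have th_sorted : sorted <%O (theta_bar th).
  by apply: sorted_theta_bar; rewrite /th run_theta; exact: sorted_sort_set.
have size_th : size (theta_bar th) = (size th).+2.
  by rewrite /= size_cat size_map addn1.
have nth_last : nth +oo%E (theta_bar th) (size th).+1 = +oo%E.
  by rewrite /= nth_cat size_map ltnn subnn.
rewrite /bracket run_bind.
have [|||] := @run_bisect (theta_bar th) (size (theta_bar th)) 0
  (size (theta_bar th)).-1.
- by rewrite size_th /=; lia.
- by [].
- by rewrite size_th nth_last.
rewrite -[run (Ret _)]/(nth _ _ _, nth _ _ _).
move: (run (bisect _ _ _ _ _ _ _ _ _)) => lo /andP[_].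
rewrite size_th => lo_lt lo_le lo_gt.
have th_bar t : t \in th -> t%:E \in theta_bar th.
  by move=> t_th; rewrite inE mem_cat map_f ?orbT.
move: (theta_bar th) size_th th_sorted lo_le lo_gt th_bar.
move=> tb size_tb tb_sorted lo_le lo_gt th_tb.
split=> //= [|t t_th].
  by rewrite (lt_sorted_ltn_nth _ tb_sorted) ?inE ?size_tb //; lia.
rewrite -/th in t_th; have := th_tb t t_th => t_tb.
(* In a strictly sorted list the order of entries is that of their indices, and every index is at
   most [lo] or at least [lo.+1]. *)
rewrite -(nth_index +oo%E t_tb).
by case: (leqP (index t%:E tb) lo) => ?; [left|right];
  rewrite (lt_sorted_leq_nth _ tb_sorted) ?inE ?index_mem // size_tb; lia.
Qed.

(** The strict bound accounts for the added infinities: the initial index gap is [size th] plus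
    one. *)
Lemma steps_bracket (th : seq R) l : (size th < 2 ^ l)%N ->
  (steps (bracket plus d u P x (theta_bar th)) <=
   l * (\sum_i (nseg (P i) + 9)).+1)%N.
Proof.
move=> th_lt; rewrite /bracket steps_bind addn0; apply: steps_bisect.
by rewrite /= size_cat size_map addn1 subn0.
Qed.

(** * Sample point and affine coefficients on the bracket *)

Lemma run_sample (l r : \bar R) :
  (l < r)%E -> (l < (run (sample (l, r)))%:E < r)%E.
Proof.
case: l => [l| |]; case: r => [r| |] //=; rewrite ?lte_fin ?ltry ?ltNyr //=.
- by move=> lr; apply/andP; split; lra.
- by move=> _; rewrite andbT; lra.
- by move=> _; lra.
Qed.

Lemma steps_sample (I : \bar R * \bar R) : (steps (sample I) <= 2)%N.
Proof. by case: I => [[?| |] [?| |]]. Qed.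

Lemma foldl_add_pair (I : Type) (f g : I -> R) ab s :
  foldl (fun ab i => (ab.1 + f i, ab.2 + g i)) ab s =
  (ab.1 + \sum_(i <- s) f i, ab.2 + \sum_(i <- s) g i).
Proof.
elim: s ab => [|i s IH] [a b] /=; first by rewrite !big_nil !addr0.
by rewrite IH !big_cons !addrA.
Qed.

Definition piece_at m i :=
  run (piece (P i) (x i ord0 - sg * (m * u i ord0 / d i ord0))).

(** This and [icpt_at] are the coefficients a and b of the output -b/a, with the piece indices read
    off at m. *)
Definition slope_at m :=
  1 + sg * \sum_i slope (P i) (piece_at m i) * (u i ord0 * u i ord0) / d i ord0.

Definition icpt_at m :=
  \sum_i u i ord0 * ((1 - slope (P i) (piece_at m i)) * x i ord0
                     - icpt (P i) (piece_at m i)).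

Lemma run_root_of I (m := run (sample I)) :
  run (root_of plus d u P x I) = - icpt_at m / slope_at m.
Proof.
rewrite /root_of 3!run_bind -/m run_bind run_foldM.
set F := (fun z i => run _).
have -> : F = fun ab i =>
    (ab.1 + slope (P i) (piece_at m i) * (u i ord0 * u i ord0) / d i ord0,
     ab.2 + u i ord0 * ((1 - slope (P i) (piece_at m i)) * x i ord0
                        - icpt (P i) (piece_at m i))).
  by apply/funext => ab; apply/funext => i; rewrite /F 2!run_bind run_shift.
rewrite foldl_add_pair !big_enum run_bind run_pm !add0r.
by rewrite /= sub0r.
Qed.

(** Each index costs 3 steps for the shift, at most k_i + 1 for the scan and 9 for the updates;
    sampling and the final formula add at most 5. *)
Lemma steps_root_of I :
  (steps (root_of plus d u P x I) <= \sum_i (nseg (P i) + 13) + 5)%N.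
Proof.
rewrite /root_of !steps_bind steps_pm.
set F := foldM _ _ _.
have F_le : (steps F <= \sum_i (nseg (P i) + 13))%N.
  rewrite -[leqRHS]big_enum; apply: steps_foldM => ab i.
  rewrite 2!steps_bind -[X in (_ + (_ + X))%N]/9%N steps_shift.
  have := steps_piece (P i) (run (Defs.shift plus d u x (run (sample I)) i)).
  by lia.
rewrite -[steps (divM _ _)]/1%N -[steps (subM _ _)]/1%N.
rewrite -[steps (constM _ 0)]/0%N -[steps (constM _ 1)]/0%N.
by have := steps_sample I; lia.
Qed.

(** * Correctness of the computed root *)

Variable g : 'I_N -> R -> \bar R.
Hypothesis d_gt0 : forall i, 0 < d i ord0.
Hypothesis gP : forall i, prox_piecewise_affine (g i) (P i).
Hypothesis L_incr : forall alpha beta, alpha < beta -> L alpha < L beta.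

(* As [alpha] moves within the closed bracket, [shift alpha i] does not cross a
   breakpoint of [P i]: the crossing would happen at an element of [theta]. *)
Lemma in_piece_bracket I m alpha i :
  bracketing I -> (I.1 < m%:E < I.2)%E -> (I.1 <= alpha%:E <= I.2)%E ->
  in_piece (P i) (piece_at m i)
    (x i ord0 - sg * (alpha * u i ord0 / d i ord0)).
Proof.
case: I => l r [/= _ _ _ no_theta] /andP[lm mr] /andP[la ar].
rewrite /piece_at; set y := fun a : R => x i ord0 - sg * (a * u i ord0 / d i ord0).
rewrite -/(y m) -/(y alpha).
have [j_le bp_lt le_bp] := run_piece (P i) (y m).
set j := run _ in j_le bp_lt le_bp *.
have [u0|u_neq0] := eqVneq (u i ord0) 0.
  have -> : y alpha = y m by rewrite /y u0 !mulr0 !mul0r.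
  by split=> // /bp_lt/ltW.
have same_side k : (1 <= k <= (nseg (P i)).+1)%N ->
    y m != bp (P i) k /\ 0 <= (y alpha - bp (P i) k) * (y m - bp (P i) k).
  move=> k_bd; have := no_theta _ (mem_theta u_neq0 k_bd).
  set t := sg * _ => t_out.
  have sg2 : sg * sg = 1 by rewrite /sgn; case: plus; rewrite ?mulrNN mulr1.
  have sg_neq0 : sg != 0 by rewrite /sgn; case: plus; rewrite ?oppr_eq0 oner_eq0.
  (* The shifted argument meets the k-th breakpoint exactly at a = t, so position relative to it is
     decided by the sign of t - a. *)
  have yE a : y a - bp (P i) k = sg * (u i ord0 / d i ord0) * (t - a).
    rewrite /y /t mulrBr [_ * (sg * _)]mulrACA sg2.
    by field; rewrite u_neq0 gt_eqF.
  have ud_neq0 : sg * (u i ord0 / d i ord0) != 0.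
    by rewrite !mulf_neq0 ?invr_eq0 // gt_eqF.
  have [mt ta] : m != t /\ 0 <= (t - alpha) * (t - m).
    case: t_out => t_out.
      have am : t <= alpha by rewrite -lee_fin (le_trans t_out).
      have tm : t < m by rewrite -lte_fin (le_lt_trans t_out).
      by split; [rewrite gt_eqF|rewrite mulr_le0 ?subr_le0 ?(ltW tm)].
    have am : alpha <= t by rewrite -lee_fin (le_trans _ t_out).
    have tm : m < t by rewrite -lte_fin (lt_le_trans _ t_out).
    by split; [rewrite lt_eqF|rewrite mulr_ge0 ?subr_ge0 ?(ltW tm)].
  rewrite -(subr_eq0 (y m)) !yE mulrACA -expr2 mulr_ge0 ?sqr_ge0 //.
  by split=> //; rewrite mulf_neq0 // subr_eq0 eq_sym.
split=> [j_gt0|j_le'].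
  have := same_side j; rewrite j_gt0 j_le => /(_ isT)[_].
  by have := bp_lt j_gt0; nra.
(* The scan gives only a weak upper bound at m; equality is excluded because m is not an element of
   [theta]. *)
have [ym_neq] := same_side j.+1 j_le'.
have := le_bp j_le'; rewrite le_eqVlt (negPf ym_neq) /=.
by nra.
Qed.

(** The pieces selected at m serve the whole closed bracket. Including the endpoints lets the signs
    found by bisection be used in the affine formula. *)
Lemma root_fun_bracket I m alpha :
  bracketing I -> (I.1 < m%:E < I.2)%E -> (I.1 <= alpha%:E <= I.2)%E ->
  L alpha = slope_at m * alpha + icpt_at m.
Proof.
move=> bI mI aI; rewrite /root_fun /slope_at /icpt_at.
rewrite mulrDl mul1r -addrA; congr (_ + _).
rewrite mulr_sumr mulr_suml -big_split; apply: eq_bigr => i _; cbv beta.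
have [j_le _ _] := run_piece (P i) (x i ord0 - sg * (m * u i ord0 / d i ord0)).
rewrite (eval_pwa_in_piece (gP i) j_le (in_piece_bracket i bI mI aI)).
by rewrite -/(piece_at m i) [RHS]/=; field; rewrite gt_eqF.
Qed.

(** The affine formula holds only on the bracket, so -b/a must first be located there: its position
    follows from the endpoint signs and a > 0, infinite endpoints being trivial. *)
Lemma root_of_bracket I :
  bracketing I -> L (run (root_of plus d u P x I)) = 0.
Proof.
move=> bI; have [lr l_le r_gt _] := bI; rewrite run_root_of.
set m := run (sample I); set a := slope_at m; set b := icpt_at m.
have mI : (I.1 < m%:E < I.2)%E by rewrite /m; case: (I) lr => ? ? /run_sample.
have /andP[lm mr] := mI.
have LE alpha := @root_fun_bracket I m alpha bI mI.
have a_gt0 : 0 < a.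
  (* Sampling between the left endpoint and m yields a second point, and strict growth of L from m'
     to m forces a > 0. *)
  have /andP[lm' m'm] := run_sample lm; set m' := run _ in lm' m'm.
  rewrite lte_fin in m'm.
  have := L_incr m'm; rewrite !LE ?(ltW lm') ?(ltW lm) ?(ltW mr) //.
    by rewrite -subr_gt0 -/a -/b => ?; nra.
  by rewrite ltW // (lt_trans _ mr) // lte_fin.
rewrite LE -/a -/b; first by field; rewrite gt_eqF.
apply/andP; split.
  have := LE; case: (I.1) l_le lm lr => [l| |] //; last by rewrite leNye.
  rewrite run_L_le0 => Ll lm lr {}LE.
  rewrite lee_fin ler_pdivlMr //.
  by move: Ll; rewrite LE ?lexx ?(ltW lr) // -/a -/b; lra.
have := LE; case: (I.2) r_gt mr lr => [r| |] //; last by rewrite leey.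
rewrite run_L_le0 -ltNge => Lr mr lr {}LE.
rewrite lee_fin ler_pdivrMr //.
by move: Lr; rewrite LE ?lexx ?(ltW lr) // -/a -/b; lra.
Qed.

End AlgorithmCorrectness.

(** * Total step count *)

Section StepCount.
Variables (R : realType) (N : nat) (plus : bool) (d u : 'cV[R]_N).
Variables (P : 'I_N -> pwa R) (x : 'cV[R]_N).

Local Notation th := (run (theta plus d u P x)).
Local Notation I := (run (bracket plus d u P x (theta_bar th))).
Local Notation alpha := (run (root_finding plus d u P x)).

Lemma run_root_finding : alpha = run (root_of plus d u P x I).
Proof.
rewrite /root_finding (run_bind (theta _ _ _ _ _)).
by rewrite (run_bind (bracket _ _ _ _ _ _)).
Qed.

Lemma steps_root_finding :
  steps (root_finding plus d u P x) =
  (steps (theta plus d u P x) +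
    (steps (bracket plus d u P x (theta_bar th)) +
     steps (root_of plus d u P x I)))%N.
Proof.
rewrite /root_finding (steps_bind (theta _ _ _ _ _)).
by rewrite (steps_bind (bracket _ _ _ _ _ _)).
Qed.

Lemma run_prox_algorithm i :
  run (prox_algorithm plus d u P x) i ord0 =
  run (eval_pwa (P i)
    (x i ord0 - sgn R plus * (alpha * u i ord0 / d i ord0))).
Proof.
rewrite /prox_algorithm (run_bind (root_finding _ _ _ _ _)).
by rewrite (run_bind (ffunM _)) mxE run_ffunM run_eval_prox.
Qed.

Lemma steps_prox_algorithmE :
  steps (prox_algorithm plus d u P x) =
  (steps (root_finding plus d u P x) +
   \sum_i steps (eval_prox plus d u P x alpha i))%N.
Proof.
rewrite /prox_algorithm (steps_bind (root_finding _ _ _ _ _)).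
by rewrite (steps_bind (ffunM _)) steps_ffunM addn0.
Qed.

Hypothesis nseg_gt0 : forall i, (0 < nseg (P i))%N.
Local Notation K := (\sum_(i < N) nseg (P i))%N.

(** Since every k_i is at least 1, a constant cost per index is absorbed into K. *)
Lemma sum_nseg_le (a b : nat) :
  (\sum_i (a * nseg (P i) + b) <= (a + b) * K)%N.
Proof.
rewrite big_distrr; apply: leq_sum => i _ /=; rewrite mulnDl leq_add2l.
by rewrite leq_pmulr.
Qed.

(** The stages add up to at most 13 K t + 58 K + 5. As K >= 2 gives t >= 1 and 5 <= 3 K, this is at
    most (13 + 61) K t. *)
Lemma steps_prox_algorithm : (2 <= K)%N ->
  (steps (prox_algorithm plus d u P x) <= 74 * (K * trunc_log 2 K))%N.
Proof.
move=> K_ge2; set t := trunc_log 2 K.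
have /andP[_ K_lt] : (2 ^ t <= K < 2 ^ t.+1)%N by apply: trunc_log_bounds; lia.
have t_gt0 : (0 < t)%N by rewrite trunc_log_gt0.
have th_lt : (2 * K < 2 ^ t.+2)%N by rewrite expnS; lia.
have S1 : (\sum_i (nseg (P i)).+1 <= 2 * K)%N.
  by under eq_bigr do rewrite -addn1 -[nseg _]mul1n; exact: sum_nseg_le 1 1.
have S4 := sum_nseg_le 4 5.
have Sc c : (\sum_i (nseg (P i) + c) <= c.+1 * K)%N.
  by under eq_bigr do rewrite -[nseg _]mul1n; exact: sum_nseg_le 1 c.
rewrite steps_prox_algorithmE steps_root_finding.
have theta_le := steps_theta plus d u x (ltnW (leq_ltn_trans S1 th_lt)).
have th_size : (size th < 2 ^ t.+2)%N.
  apply: leq_ltn_trans th_lt; apply: leq_trans S1.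
  rewrite run_theta (leq_trans (size_sort_set _)) //.
  exact: size_all_breakpoints.
have bracket_le := steps_bracket plus d u P x th_size.
have root_le := steps_root_of plus d u P x I.
have prox_le : (\sum_i steps (eval_prox plus d u P x alpha i) <= 7 * K)%N.
  by apply: leq_trans (Sc 6); apply: leq_sum => i _; exact: steps_eval_prox.
have {}theta_le : (steps (theta plus d u P x) <= 9 * K + t.+3 * (2 * K))%N.
  by apply: leq_trans theta_le _; rewrite leq_add // leq_mul2l S1 orbT.
have {}bracket_le : (steps (bracket plus d u P x (theta_bar th)) <=
    t.+2 * (11 * K))%N.
  apply: leq_trans bracket_le _; rewrite leq_mul //.
  by have := Sc 9; rewrite -ltnS => /leq_trans; apply; lia.
have tK : (K <= K * t)%N by rewrite leq_pmulr.
have e1 : (t.+3 * (2 * K) = 2 * (K * t) + 6 * K)%N by lia.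
have e2 : (t.+2 * (11 * K) = 11 * (K * t) + 22 * K)%N by lia.
rewrite {}e1 in theta_le; rewrite {}e2 in bracket_le.
have {Sc}root_le := leq_trans root_le (leq_add (Sc 13) (leqnn 5)).
apply: leq_trans
  (leq_add (leq_add theta_le (leq_add bracket_le root_le)) prox_le) _.
move: K_ge2 tK; clear; move: (K * t)%N K; lia.
Qed.

End StepCount.

(** * Passage to the natural logarithm and optimality of the output *)

Lemma trunc_log2_le_ln (R : realType) n :
  (0 < n)%N -> (trunc_log 2 n)%:R * ln 2 <= ln n%:R :> R.
Proof.
move=> n_gt0; rewrite mulr_natl -lnXn // ler_ln ?posrE ?exprn_gt0 ?ltr0n //.
by rewrite -natrX ler_nat; have /andP[] := trunc_log_bounds (isT : 1 < 2)%N n_gt0.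
Qed.

(** The constant is chosen before all problem data, so the bound is uniform. The guard on K is there
    because K ln K vanishes at K = 1. *)
Theorem proposition3p13 (R : realType) :
  exists C : R, forall (N : nat) (plus : bool) (d u : 'cV[R]_N)
    (h : 'cV[R]_N -> \bar R) (hi : 'I_N -> R -> \bar R) (P : 'I_N -> pwa R),
    Gamma0 h ->
    (forall i z, hi i z != -oo%E) ->
    (forall z, h z = (\sum_(i < N) hi i (z i ord0))%E) ->
    (forall i, 0 < d i ord0) ->
    sym_posdef (metric plus d u) ->
    (forall i, prox_piecewise_affine
                 (fun z => ((d i ord0)^-1%:E * hi i z)%E) (P i)) ->
    let K := (\sum_(i < N) nseg (P i))%N in
    forall x : 'cV[R]_N,
      proxV (metric plus d u) h x = [set run (prox_algorithm plus d u P x)] /\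
      ((2 <= K)%N ->
       (steps (prox_algorithm plus d u P x))%:R <= C * (K%:R * ln K%:R)).
Proof.
have ln2_gt0 : 0 < ln 2 :> R by rewrite ln_gt0 // ltr1n.
exists (74 / ln 2) => N plus d u h hi P [[_ [z0 hz0]] _ h_convex] hiNy hE.
move=> d_gt0 Vpos hiP K x; split; last first.
  move=> K_ge2; have nseg_gt0 i : (0 < nseg (P i))%N by case: (hiP i).
  have := steps_prox_algorithm plus d u x nseg_gt0 K_ge2.
  rewrite -(ler_nat R) => /le_trans; apply.
  rewrite -mulrA [_^-1 * _]mulrC -mulrA !natrM ler_pM2l ?ltr0n //.
  rewrite ler_wpM2l // ler_pdivlMr //; apply: trunc_log2_le_ln.
  exact: leq_trans K_ge2.
pose q i y := run (eval_pwa (P i) y).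
have q_sub i y := @prox_subgradient _ (hi i) (d i ord0) (z0 i ord0) y (q i y)
  (d_gt0 i) (hiNy i) (separable_fin_num hiNy hE hz0 i)
  (@separable_convex _ _ _ _ hiNy hE _ hz0 h_convex i).
have {}q_sub i y : hi i (q i y) \is a fin_num /\ forall z,
    (hi i (q i y) + (d i ord0 * (y - q i y) * (z - q i y))%:E <= hi i z)%E.
  by apply: q_sub; rewrite (prox_eval_pwa y (hiP i)).
have q_fne i y y' : 0 <= ((y - y') - (q i y - q i y')) * (q i y - q i y').
  have [? ?] := q_sub i y; have [? ?] := q_sub i y'.
  exact: (@subgradients_firmly_nonexpansive _ (hi i) (d i ord0)).
have L_incr := root_fun_increasing x d_gt0 Vpos q_fne.
set p := run (prox_algorithm plus d u P x).
pose alpha := run (root_finding plus d u P x).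
have L0 : root_fun plus d u x q alpha = 0.
  rewrite /alpha run_root_finding.
  exact: (root_of_bracket d_gt0 hiP L_incr (bracketing_bracket _ _ _ _ _)).
have pE i := run_prox_algorithm plus d u P x i.
(* At the root of L the inner product of u and x - p is -alpha, which turns the i-th entry of V (x -
   p) into the scalar subgradient supplied by [q_sub]. *)
have V_grad i : (metric plus d u *m (x - p)) i ord0 =
    d i ord0 * (x i ord0 - sgn R plus * (alpha * u i ord0 / d i ord0) - p i ord0).
  rewrite mul_metricE (_ : \sum_j _ = - alpha).
    by rewrite !mxE; field; rewrite gt_eqF.
  move/eqP: L0; rewrite /root_fun addrC addr_eq0 => /eqP <-.
  by apply: eq_bigr => j _; rewrite !mxE pE.
apply: (proxV_separable Vpos hE) => [i|i c].
  by rewrite pE; apply: (q_sub i _).1.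
by rewrite V_grad pE; apply: (q_sub i _).2.
Qed.
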